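(* Let $J^*(\theta)=\tfrac12\|t(\exp(\theta))\|_2^2$ for $\theta\in\mathfrak{se}(3)$, where $t(\cdot)$ extracts the translation. For every $R\ge2$, the point $\theta_R=(e_1,\sqrt{R^2-1}\,e_3)\in\mathfrak{se}(3)$ (i.e. $\omega=e_1$, $v=\sqrt{R^2-1}\,e_3$) satisfies $\|\theta_R\|_F=R$, and $$L_{J^*}(R;\mathfrak{se}(3))\;\ge\;\tfrac38\,|\phi''(1)|\,R^2 ,$$ where $\phi(s)=\left(\frac{1-\cos s}{s}\right)^2+\left(\frac{\sin s}{s}\right)^2$ and $\phi''(1)=-8\sin 1-10\cos 1+12\approx-0.1348$ (so that $\tfrac38|\phi''(1)|\approx 0.0505$).
   Context: The Lie algebra $\mathfrak{se}(3)$ consists of the real $4\times4$ matrices $\begin{pmatrix}\Omega & v\\ 0&0\end{pmatrix}$ with $v\in\mathbb{R}^3$ and $\Omega$ a $3\times3$ skew-symmetric matrix with axial vector $\omega\in\mathbb{R}^3$ (i.e. $\Omega x=\omega\times x$). Such an element is identified with $\theta=(\omega,v)\in\mathbb{R}^3\times\mathbb{R}^3=\mathbb{R}^6$, with the 6-vector norm $\|\theta\|_F=(\|\omega\|^2+\|v\|^2)^{1/2}$. $\exp(\theta)$ is the matrix exponential, which has the form $\begin{pmatrix}Q&t\\0&1\end{pmatrix}$ with $Q\in\mathrm{SO}(3)$ and $t\in\mathbb{R}^3$; for such a matrix $g$, $t(g)=t$ denotes the translation part. $e_1,e_2,e_3$ is the standard basis of $\mathbb{R}^3$. For a smooth $J:\mathfrak{se}(3)\to\mathbb{R}$,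 $\nabla J$ is the gradient on $\mathbb{R}^6\cong\mathfrak{se}(3)$ with the Euclidean (6-vector) inner product, and $$L_J(R;\mathfrak{se}(3))=\sup_{\substack{\|\theta\|_F,\|\theta'\|_F\le R\\ \theta\neq\theta'}}\frac{\|\nabla J(\theta)-\nabla J(\theta')\|_F}{\|\theta-\theta'\|_F}.$$ *)

(* Defs.v *)
From HB Require Import structures.
From mathcomp Require Import all_boot all_order all_algebra.
From mathcomp Require Import all_classical all_reals all_analysis.

Set Implicit Arguments.
Unset Strict Implicit.
Unset Printing Implicit Defensive.

Import Order.TTheory GRing.Theory Num.Theory.
Import numFieldNormedType.Exports.

Local Open Scope classical_set_scope.
Local Open Scope ring_scope.

(* The library norm on matrices is the sup norm, which has the same topology
   (hence the same limits and derivatives) but not the same Lipschitz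
   constants: the Euclidean norm is spelled out. *)
Definition norm2 (R : realType) (n : nat) (x : 'cV[R]_n) : R :=
  Num.sqrt (\sum_(i < n) x i 0 ^+ 2).

(* Index arithmetic in 'I_3 is modulo 3. *)
Definition crossmul (R : realType) (u v : 'cV[R]_3) : 'cV[R]_3 :=
  \col_i (u (i + 1) 0 * v (i + 2%:R) 0 - u (i + 2%:R) 0 * v (i + 1) 0).

(* The skew-symmetric matrix with axial vector w; see [hat_mulE], [tr_hat]. *)
Definition hat (R : realType) (w : 'cV[R]_3) : 'M[R]_3 :=
  \matrix_(i, j) crossmul w (delta_mx j 0) i 0.

Lemma hat_mulE (R : realType) (w x : 'cV[R]_3) : hat w *m x = crossmul w x.
Proof.
have [w_ wE] : exists f : nat -> R, forall i : 'I_3, w i 0 = f i.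
  by exists (fun k => w (inord k) 0) => i; rewrite inord_val.
have [x_ xE] : exists f : nat -> R, forall i : 'I_3, x i 0 = f i.
  by exists (fun k => x (inord k) 0) => i; rewrite inord_val.
apply/colP => i; rewrite !mxE !big_ord_recr big_ord0 /= !mxE !wE !xE.
by case: i => [[|[|[|]]]] //= ?;
   rewrite ?(mulr0, mulr1, mul0r, addr0, add0r, sub0r, subr0, mulNr,
               oppr0) //; exact: addrC.
Qed.

Lemma tr_hat (R : realType) (w : 'cV[R]_3) : (hat w)^T = - hat w.
Proof.
have [w_ wE] : exists f : nat -> R, forall i : 'I_3, w i 0 = f i.
  by exists (fun k => w (inord k) 0) => i; rewrite inord_val.
apply/matrixP => i j; rewrite !mxE !wE.
by case: i => [[|[|[|]]]] //= ?; case: j => [[|[|[|]]]] //= ?;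
   rewrite ?(mulr0, mulr1, addr0, sub0r, subr0, oppr0, opprK).
Qed.

(* theta = (omega, v) in R^6 is [col_mx omega v]. *)
Definition se3_mx (R : realType) (theta : 'cV[R]_(3 + 3)) : 'M[R]_(3 + 1) :=
  block_mx (hat (usubmx theta)) (dsubmx theta) 0 0.

Definition normF (R : realType) (theta : 'cV[R]_(3 + 3)) : R :=
  Num.sqrt (norm2 (usubmx theta) ^+ 2 + norm2 (dsubmx theta) ^+ 2).

Definition mexp (R : realType) (n : nat) (A : 'M[R]_n) : 'M[R]_n :=
  limn (series (fun k : nat => (k`!%:R : R)^-1 *: A ^+ k)).

Definition translation (R : realType) (g : 'M[R]_(3 + 1)) : 'cV[R]_3 :=
  ursubmx g.

Definition grad (R : realType) (n : nat) (J : 'cV[R]_n -> R) (x : 'cV[R]_n) :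
    'cV[R]_n :=
  \col_i 'D_(delta_mx i 0) J x.

Definition lipschitz_grad (R : realType) (J : 'cV[R]_(3 + 3) -> R) (r : R) :
    \bar R :=
  ereal_sup [set x : \bar R | exists theta theta' : 'cV[R]_(3 + 3),
    [/\ normF theta <= r, normF theta' <= r, theta != theta' &
        x = (normF (grad J theta - grad J theta') / normF (theta - theta'))%:E]].

Definition Jstar (R : realType) (theta : 'cV[R]_(3 + 3)) : R :=
  2^-1 * norm2 (translation (mexp (se3_mx theta))) ^+ 2.

Definition thetaR (R : realType) (r : R) : 'cV[R]_(3 + 3) :=
  col_mx (delta_mx 0 0) (Num.sqrt (r ^+ 2 - 1) *: delta_mx 2%:R 0).

Definition phi (R : realType) (s : R) : R :=
  ((1 - cos s) / s) ^+ 2 + (sin s / s) ^+ 2.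

(* Main.v *)
Require Import Defs.
From HB Require Import structures.
From mathcomp Require Import all_boot all_order all_algebra.
From mathcomp Require Import all_classical all_reals all_analysis.
From mathcomp Require Import ring lra zify.

Import Order.TTheory GRing.Theory Num.Theory.
Import numFieldNormedType.Exports.

Local Open Scope classical_set_scope.
Local Open Scope ring_scope.

(* On the half-line theta(s) = (s e_1, a e_3), s > 0, the generator A satisfies
   A^3 = - s^2 A, so exp A = 1 + (sin s / s) A + ((1 - cos s) / s^2) A^2 and the
   translation part has squared norm a^2 phi(s). Hence the first entry of the
   gradient of J* along this line is (a^2 / 2) phi'(s). With a^2 = R^2 - 1, all
   theta(s) with 0 < s <= 1 lie in the ball of radius R, and the secants from
   theta(s) to theta(1) = theta_R, s -> 1-, give
   L >= ((R^2 - 1) / 2) |phi''(1)| >= (3 / 8) |phi''(1)| R^2 for R >= 2. *)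

(** * Numerical bounds from alternating series *)

(** After multiplication by (-1)^n the tail starts with a positive term, and grouping it in
    consecutive pairs gives strictly positive summands. *)
Lemma lt_sum_limn_alternating (R : realFieldType) (u : R ^nat) n :
    (forall k, 0 < u k.+1 < u k) ->
    cvgn (series (fun k => (-1) ^+ k * u k)) ->
  0 < (-1) ^+ n *
      (limn (series (fun k => (-1) ^+ k * u k)) -
       \sum_(0 <= k < n) (-1) ^+ k * u k).
Proof.
move=> u_dec cu.
pose v := (-1) ^+ n *: (fun k : nat => (-1) ^+ k * u k).
have cv : cvgn (series v) by apply: is_cvg_seriesZ.
have := @lt_sum_lim_series _ v n cv.
rewrite lim_seriesZ // /v /GRing.scale /=.
rewrite -mulr_sumr mulrBr subr_gt0; apply => d.
rewrite !exprD !exprS -!mulrA.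
have -> : ((-1 : R) ^+ d.*2) = 1 by rewrite -mul2n exprM sqrrN expr1n expr1n.
rewrite /GRing.scale /= !mulrA -expr2 sqrr_sign !mul1r mulN1r.
have /andP[] := u_dec (n + d.*2)%N.
by rewrite addnS; lra.
Qed.

Lemma ltr_invfactSS (R : numFieldType) n : 0 < (n.+2`!%:R : R)^-1 < (n`!%:R : R)^-1.
Proof.
rewrite invr_gt0 ltr0n fact_gt0 /= ltf_pV2 ?posrE ?ltr0n ?fact_gt0 //.
by rewrite ltr_nat !factS mulnA ltn_Pmull ?fact_gt0 //; nia.
Qed.

Lemma sin1_partial (R : realType) n :
  0 < (-1) ^+ n * (sin 1 - \sum_(0 <= k < n) (-1) ^+ k * (k.*2.+1`!%:R)^-1 :> R).
Proof.
have sE : series (sin_coeff' (1 : R)) = series (fun k => (-1) ^+ k * (k.*2.+1`!%:R)^-1).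
  by congr series; apply/funext => k; rewrite /sin_coeff' expr1n mulr1.
have := @cvg_sin_coeff' R 1; rewrite sE => c.
rewrite -(cvg_lim _ c) //.
apply: (@lt_sum_limn_alternating _ (fun k => (k.*2.+1`!%:R)^-1)); last first.
  by apply/cvg_ex; exists (sin 1).
by move=> k; exact: ltr_invfactSS.
Qed.

Lemma cos1_partial (R : realType) n :
  0 < (-1) ^+ n * (cos 1 - \sum_(0 <= k < n) (-1) ^+ k * (k.*2`!%:R)^-1 :> R).
Proof.
have sE : series (cos_coeff' (1 : R)) = series (fun k => (-1) ^+ k * (k.*2`!%:R)^-1).
  by congr series; apply/funext => k; rewrite /cos_coeff' expr1n mulr1.
have := @cvg_cos_coeff' R 1; rewrite sE => c.
rewrite -(cvg_lim _ c) //.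
apply: (@lt_sum_limn_alternating _ (fun k => (k.*2`!%:R)^-1)); last first.
  by apply/cvg_ex; exists (cos 1).
by move=> k; rewrite doubleS; exact: ltr_invfactSS.
Qed.

(** The lower bound is 0.1348 - 5/10^5; the upper bound is 8/3 of 0.0505 + 5/10^5, that is 0.1348.
    They are the sharper sides of the two roundings in the theorem. *)
Lemma sin1_cos1_bounds (R : realType) :
  539 / (4 * 10 ^+ 3) <= 8 * sin 1 + 10 * cos (1 : R) - 12 <= 337 / (25 * 10 ^+ 2).
Proof.
(* [f] hides the factorials, which unification would otherwise evaluate in
   unary. *)
have [f [f0 fS fE]] : exists f : nat -> R,
    [/\ f 0 = 1, forall n, f n.+1 = n.+1%:R * f n & forall n, n`!%:R = f n].
  by exists (fun n => n`!%:R); split => // n; rewrite factS natrM.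
(* Even orders bound from below, odd orders from above. *)
have s4 := sin1_partial R 4; have s5 := sin1_partial R 5.
have c5 := cos1_partial R 5; have c6 := cos1_partial R 6.
do ![rewrite big_nat_recr //= fE in s4 s5 c5 c6].
rewrite !big_geq // !doubleS double0 !fS f0 in s4 s5 c5 c6.
lra.
Qed.

(** * Derivatives of [phi] *)

Lemma is_derive_phi (R : realType) (s : R) : s != 0 ->
  is_derive s 1 (@phi R) (2 * (s * sin s + 2 * cos s - 2) / s ^+ 3).
Proof.
move=> s0.
have dV : is_derive s 1 (fun y : R => y^-1) (- s ^- 2 *: 1).
  exact: (@is_deriveV _ id).
rewrite /phi; apply: trigger_derive.
rewrite /GRing.scale /=.
have cs := cos2Dsin2 s; set l := LHS.
(* Isolates cos^2 + sin^2, which [field] cannot simplify. *)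
have -> : l = 2 * (s * sin s + 2 * cos s - 1 - (cos s ^+ 2 + sin s ^+ 2)) / s ^+ 3.
  by rewrite /l; field.
by rewrite cs; field.
Qed.

Lemma is_derive_phi2 (R : realType) (s : R) : s != 0 ->
  is_derive s 1 (derive1 (@phi R))
  (2 * (s ^+ 2 * cos s - 4 * s * sin s - 6 * cos s + 6) / s ^+ 4).
Proof.
move=> s0.
pose f (u : R) := 2 * (u * sin u + 2 * cos u - 2) * (u ^+ 3)^-1.
have dV : is_derive s 1 (fun y : R => (y ^+ 3)^-1) (- (s ^+ 3) ^- 2 *: (3%:R * s ^+ 2)).
  apply: (@is_deriveV _ (fun y => y ^+ 3)); first by rewrite expf_neq0.
  by apply: trigger_derive; rewrite /GRing.scale /=; ring.
(* The closed form of the first derivative is available only off 0; agreement near s suffices. *)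
have fphi : \near s, f s = derive1 (@phi R) s.
  have : \forall x \near s, x != 0 by exact: open_neq.
  apply: filterS => u u0.
  by rewrite derive1E; have [_ ->] := is_derive_phi _ u u0.
apply: near_eq_is_derive fphi _.
by rewrite /f; apply: trigger_derive; rewrite /GRing.scale /=; field.
Qed.

Lemma derive1n2_phi (R : realType) : derive1n 2 (@phi R) 1 = - 8 * sin 1 - 10 * cos 1 + 12.
Proof.
rewrite /derive1n /= derive1E; have [_ ->] := is_derive_phi2 _ (1 : R) (oner_neq0 _).
by field.
Qed.

(** * Exponential of a matrix with A^3 = - s^2 A *)

Lemma exprS_double_cube (R : realType) n (A : 'M[R]_n) (s : R) (m : nat) :
  A ^+ 3 = - s ^+ 2 *: A -> A ^+ m.*2.+1 = (- s ^+ 2) ^+ m *: A.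
Proof.
move=> A3; elim: m => [|m IHm]; first by rewrite scale1r expr1.
rewrite doubleS 2!exprSr IHm -!mulmxE -!scalemxAl !mulmxE -mulrA -expr2 -exprS.
by rewrite A3 scalerA -exprSr.
Qed.

Lemma mexp_cube (R : realType) n (A : 'M[R]_n) (s : R) :
  s != 0 -> A ^+ 3 = - s ^+ 2 *: A ->
  mexp A = 1 + (sin s / s) *: A + ((1 - cos s) / s ^+ 2) *: A ^+ 2.
Proof.
move=> s0 A3.
(* Coefficients of the constant series 1: they supply the identity and cancel the A^2 term that the
   cosine series contributes at k = 0. *)
pose d (k : nat) : R := (k == 0)%:R.
have cd : series d @ \oo --> (1 : R).
  apply: cvg_near_cst; near=> k.
  rewrite /series /= -[k]prednK; last by near: k; exists 1%N.
  by rewrite big_nat_recl // big1 ?addr0.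
have cs : series (sin_coeff s) @ \oo --> sin s.
  by rewrite unlock; exact: is_cvg_series_sin_coeff.
have cc : series (cos_coeff s) @ \oo --> cos s.
  by rewrite unlock; exact: is_cvg_series_cos_coeff.
have termE k : (k`!%:R : R)^-1 *: A ^+ k =
    d k *: (1 + s ^- 2 *: A ^+ 2) + sin_coeff s k *: (s^-1 *: A)
      + cos_coeff s k *: (- s ^- 2 *: A ^+ 2).
  case: k => [|k].
    rewrite /d /sin_coeff /cos_coeff /= !(mul1r, mulr1, mul0r) fact0 invr1.
    by rewrite scale0r !scale1r expr0 scaleNr addr0 addrK.
  rewrite /d scale0r add0r /sin_coeff /cos_coeff /=.
  (* The exponent is k + 1, so odd k gives an even power, reduced as A times an odd one. *)
  have [ok|ek] := boolP (odd k).
    rewrite -(odd_double_half k) ok add1n -doubleS /= uphalf_double /=.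
    rewrite !doubleS exprS (exprS_double_cube _ _ A s) // -mulmxE -scalemxAr mulmxE.
    rewrite -expr2 !mul0r scale0r add0r mul1r !scalerA; congr (_ *: _).
    rewrite doubleK -?exprnP [(- s ^+ 2) ^+ _]exprNn -exprM 2!exprS mul2n exprS.
    by field; rewrite s0 pnatr_eq0 -lt0n fact_gt0.
  rewrite -(odd_double_half k) (negbTE ek) add0n /= doubleK.
  rewrite (exprS_double_cube _ _ A s) // !mul0r scale0r addr0 mul1r.
  rewrite !scalerA; congr (_ *: _).
  rewrite ?uphalf_double -?exprnP [(- s ^+ 2) ^+ _]exprNn -exprM exprS mul2n.
  by field; rewrite s0 pnatr_eq0 -lt0n fact_gt0.
apply: cvg_lim => //.
have -> : series (fun k => (k`!%:R : R)^-1 *: A ^+ k) =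
    (fun m => series d m *: (1 + s ^- 2 *: A ^+ 2) + series (sin_coeff s) m *: (s^-1 *: A)
      + series (cos_coeff s) m *: (- s ^- 2 *: A ^+ 2)).
  apply/funext => m; rewrite /series /= !scaler_suml -!big_split /=.
  by apply: eq_bigr => k _; rewrite termE.
have -> : 1 + (sin s / s) *: A + ((1 - cos s) / s ^+ 2) *: A ^+ 2 =
   (1 : R) *: (1 + s ^- 2 *: A ^+ 2) + sin s *: (s^-1 *: A)
      + cos s *: (- s ^- 2 *: A ^+ 2).
  rewrite scale1r !scalerA mulrBl scalerBl mul1r mulrN scaleNr.
  by rewrite addrA; congr (_ - _); rewrite addrAC.
by apply: cvgD; [apply: cvgD|]; apply: cvgZr_tmp.
Unshelve. all: by end_near. Qed.

(** * Cross products and the translation part *)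

Lemma crossmul_crossmul (R : realType) (w x : 'cV[R]_3) :
  crossmul w (crossmul w x) =
  (\sum_i w i 0 * x i 0) *: w - (\sum_i w i 0 ^+ 2) *: x.
Proof.
(* Entries read through a function on [nat] depend only on the value of the index, so [ring] can
   identify them. *)
have [w_ wE] : exists f : nat -> R, forall i : 'I_3, w i 0 = f i.
  by exists (fun k => w (inord k) 0) => i; rewrite inord_val.
have [x_ xE] : exists f : nat -> R, forall i : 'I_3, x i 0 = f i.
  by exists (fun k => x (inord k) 0) => i; rewrite inord_val.
apply/colP => i; rewrite !big_ord_recr !big_ord0 /= !mxE !wE !xE.
by case: i => [[|[|[|]]]] //= ?; ring.
Qed.

Lemma dot_crossmul (R : realType) (w x : 'cV[R]_3) :
  \sum_i w i 0 * crossmul w x i 0 = 0.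
Proof.
have [w_ wE] : exists f : nat -> R, forall i : 'I_3, w i 0 = f i.
  by exists (fun k => w (inord k) 0) => i; rewrite inord_val.
have [x_ xE] : exists f : nat -> R, forall i : 'I_3, x i 0 = f i.
  by exists (fun k => x (inord k) 0) => i; rewrite inord_val.
by rewrite !big_ord_recr !big_ord0 /= !mxE !wE !xE /=; ring.
Qed.

Lemma se3_mxSS (R : realType) (w v : 'cV[R]_3) k :
  se3_mx (col_mx w v) ^+ k.+1 =
  block_mx (hat w ^+ k.+1) (hat w ^+ k *m v) 0 0.
Proof.
elim: k => [|k IHk]; first by rewrite /se3_mx col_mxKu col_mxKd !expr1 expr0 mul1mx.
rewrite exprS IHk /se3_mx col_mxKu col_mxKd -mulmxE mulmx_block.
by rewrite !(mul0mx, mulmx0, addr0) mulmxA !mulmxE -!exprS.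
Qed.

(** The last column of A^3 is (w.v) w - |w|^2 v, so orthogonality of w and v yields A^3 = - s^2
    A. *)
Lemma translation_mexp (R : realType) (w v : 'cV[R]_3) (s : R) :
  s != 0 -> \sum_i w i 0 ^+ 2 = s ^+ 2 -> \sum_i w i 0 * v i 0 = 0 ->
  translation (mexp (se3_mx (col_mx w v))) =
  (sin s / s) *: v + ((1 - cos s) / s ^+ 2) *: crossmul w v.
Proof.
move=> s0 ws wv.
rewrite (mexp_cube _ _ _ s) //; last first.
  rewrite se3_mxSS [in RHS]/se3_mx col_mxKu col_mxKd scale_block_mx !scaler0.
  congr block_mx.
    apply/matrixP => i j.
    (* Column j is the triple product of w, w and w x e_j, the last being orthogonal to w. *)
    suff cj : col j (hat w ^+ 3) = col j (- s ^+ 2 *: hat w).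
      by move/colP/(_ i): cj; rewrite !mxE.
    rewrite !colE exprS expr2 -!mulmxE -!mulmxA -scalemxAl !hat_mulE crossmul_crossmul.
    by rewrite dot_crossmul scale0r sub0r ws scaleNr.
  by rewrite expr2 -mulmxE -mulmxA !hat_mulE crossmul_crossmul wv scale0r
    add0r ws scaleNr.
rewrite se3_mxSS {1}/se3_mx col_mxKu col_mxKd.
rewrite -[1]/(1%:M) scalar_mx_block !scale_block_mx !add_block_mx /translation block_mxKur.
by rewrite add0r hat_mulE.
Qed.

(** Since e_1 x e_3 = - e_2, the two terms of the translation are orthogonal, of lengths |a sin s /
    s| and |a (1 - cos s) / s|. *)
Lemma Jstar_line (R : realType) (s a : R) : s != 0 ->
  Jstar (col_mx (s *: delta_mx 0 0) (a *: delta_mx 2%:R 0)) = a ^+ 2 / 2 * phi s.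
Proof.
move=> s0; rewrite /Jstar (translation_mexp _ _ _ s) //.
- rewrite /norm2 sqr_sqrtr; last by apply: sumr_ge0 => i _; exact: sqr_ge0.
  rewrite !big_ord_recr big_ord0 /= !mxE /=.
  by rewrite /phi; field.
- by rewrite !big_ord_recl big_ord0 /= !mxE /=; ring.
- by rewrite !big_ord_recl big_ord0 /= !mxE /=; ring.
Qed.

(** * The gradient along the line *)

(** Both sides are limits of the same difference quotient. *)
Lemma derive_lineE (R : realType) (V : normedModType R) (J : V -> R) (v y : V)
    (s : R) :
  'D_v J (s *: v + y) = derive1 (fun u => J (u *: v + y)) s.
Proof.
rewrite /derive1 /derive.
set f := (X in lim (X @ _) = _); set g := (X in _ = lim (X @ _)).
suff -> : f = g by [].
by apply/funext => h; rewrite /f /g /= scalerDl addrA.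
Qed.

Lemma col_mx_line (R : realType) (s : R) (v : 'cV[R]_3) :
  col_mx (s *: delta_mx 0 0) v =
  s *: delta_mx (@lshift 3 3 0) 0 + col_mx 0 v.
Proof.
have -> : delta_mx (@lshift 3 3 0) 0 = col_mx (delta_mx 0 0) 0 :> 'cV[R]_(3 + 3).
  apply/colP => i; rewrite !mxE andbT; case: splitP => j ij; rewrite !mxE ?andbT.
    by congr (_%:R); rewrite -!val_eqE /= ij.
  by rewrite -val_eqE /= ij.
by rewrite scale_col_mx scaler0 add_col_mx addr0 add0r.
Qed.

Lemma grad_Jstar_line (R : realType) (s a : R) : s != 0 ->
  grad (@Jstar R) (col_mx (s *: delta_mx 0 0) (a *: delta_mx 2%:R 0))
    (@lshift 3 3 0) 0 =
  a ^+ 2 / 2 * derive1 (@phi R) s.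
Proof.
move=> s0; rewrite mxE col_mx_line derive_lineE.
have [dphi _] := is_derive_phi _ s s0.
rewrite !derive1E -[RHS]deriveZ //; apply: near_eq_derive.
have : \forall u \near s, u != 0 by exact: open_neq.
by apply: filterS => u u0; rewrite -col_mx_line Jstar_line.
Qed.

(** * Norms and the Lipschitz lower bound *)

Lemma normFE (R : realType) (theta : 'cV[R]_(3 + 3)) :
  normF theta = Num.sqrt (\sum_i theta i 0 ^+ 2).
Proof.
rewrite /normF !sqr_sqrtr ?sumr_ge0 // => [|i _|i _]; try exact: sqr_ge0.
rewrite big_split_ord /=; congr (Num.sqrt (_ + _));
  by apply: eq_bigr => i _; rewrite !mxE.
Qed.

Lemma ler_normF (R : realType) (theta : 'cV[R]_(3 + 3)) i :
  `|theta i 0| <= normF theta.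
Proof.
rewrite normFE -sqrtr_sqr ler_wsqrtr // (bigD1 i) //= lerDl.
by apply: sumr_ge0 => j _; exact: sqr_ge0.
Qed.

Lemma normF_line (R : realType) (s a : R) :
  normF (col_mx (s *: delta_mx 0 0) (a *: delta_mx 2%:R 0)) =
  Num.sqrt (s ^+ 2 + a ^+ 2).
Proof.
rewrite /normF col_mxKu col_mxKd /norm2.
rewrite !sqr_sqrtr ?sumr_ge0 // => [|i _|i _]; try exact: sqr_ge0.
by congr Num.sqrt; rewrite !big_ord_recl !big_ord0 !mxE /=; ring.
Qed.

(** The limit is taken from the left because theta(1 + h) leaves the ball for h > 0. *)
Lemma cvg_derive1_at_left (R : realType) (f : R -> R) (x : R) :
  derivable f x 1 ->
  h^-1 * (f (h + x) - f x) @[h --> 0^'-] --> derive1 f x.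
Proof.
move=> df; apply: cvg_dnbhs_at_left; rewrite derive1E.
suff <- : (fun h => h^-1 *: ((f \o shift x) (h *: 1) - f x)) =
          (fun h => h^-1 * (f (h + x) - f x)) by exact: df.
by apply/funext => h /=; rewrite [h *: 1]mulr1.
Qed.

(* The entries are passed through equations because rewriting in
   [grad (@Jstar R) theta] makes unification unfold [Jstar]. *)
Lemma lipschitz_grad_ge (R : realType) (J : 'cV[R]_(3 + 3) -> R) (r : R)
    (theta theta' : 'cV[R]_(3 + 3)) i (g g' : R) :
  normF theta <= r -> normF theta' <= r -> theta != theta' ->
  grad J theta i 0 = g -> grad J theta' i 0 = g' ->
  ((`|g - g'| / normF (theta - theta'))%:E <= lipschitz_grad J r)%E.
Proof.
move=> ler ler' neq <- <-; apply: ereal_sup_ge.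
exists (normF (grad J theta - grad J theta') / normF (theta - theta'))%:E.
  by exists theta, theta'.
rewrite lee_fin ler_wpM2r ?invr_ge0 ?sqrtr_ge0 //.
have -> : grad J theta i 0 - grad J theta' i 0 = (grad J theta - grad J theta') i 0.
  by rewrite !mxE.
exact: ler_normF.
Qed.

Lemma lipschitz_grad_Jstar_ge (R : realType) (r : R) : 1 <= r ->
  (((r ^+ 2 - 1) / 2 * `|derive1n 2 (@phi R) 1|)%:E <= lipschitz_grad (@Jstar R) r)%E.
Proof.
move=> r1.
set a := Num.sqrt (r ^+ 2 - 1).
have a2 : a ^+ 2 = r ^+ 2 - 1 by rewrite sqr_sqrtr // subr_ge0; nra.
pose q (h : R) := h^-1 * (derive1 (@phi R) (h + 1) - derive1 (@phi R) 1).
have [dphi _] := is_derive_phi2 _ (1 : R) (oner_neq0 _).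
have cq : (a ^+ 2 / 2 * `|q h|)%:E @[h --> 0^'-] -->
    (a ^+ 2 / 2 * `|derive1n 2 (@phi R) 1|)%:E.
  apply: cvg_EFin; first by near=> h.
  apply: cvgM; first exact: cvg_cst.
  by apply: cvg_norm; exact: cvg_derive1_at_left.
(* It suffices to bound each secant quotient near 0 from the left. *)
rewrite -a2 -(cvg_lim _ cq) //; apply: lime_le.
  by apply/cvg_ex; eexists; exact: cq.
near=> h.
have h0 : h < 0 by near: h; exact: nbhs_left_lt.
have h1 : -1 < h by near: h; apply: nbhs_left_gt; rewrite oppr_lt0.
have s0 : h + 1 != 0 by rewrite gt_eqF //; lra.
pose theta (s : R) : 'cV[R]_(3 + 3) :=
  col_mx (s *: delta_mx 0 0) (a *: delta_mx 2%:R 0).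
have normth s : 0 < s <= 1 -> normF (theta s) <= r.
  move=> s01; rewrite normF_line a2 -[leRHS]ger0_norm; last lra.
  rewrite -sqrtr_sqr ler_wsqrtr //; nra.
have normB : normF (theta (h + 1) - theta 1) = - h.
  rewrite /theta opp_col_mx add_col_mx subrr -scalerBl addrK.
  (* The difference is a point of the line with a = 0. *)
  by rewrite -(scale0r (delta_mx 2%:R 0)) normF_line expr0n addr0 sqrtr_sqr ltr0_norm.
have thN1 : theta (h + 1) != theta 1.
  apply/eqP => th; move: normB; rewrite th subrr normFE big1 ?sqrtr0 => [|i _].
    by lra.
  by rewrite mxE expr0n.
have hB : 0 < h + 1 <= 1 by lra.
have oneB : 0 < (1 : R) <= 1 by lra.
have := lipschitz_grad_ge _ _ _ _ _ _ _ _ (normth _ hB) (normth _ oneB) thN1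
  (grad_Jstar_line _ _ a s0) (grad_Jstar_line _ _ a (oner_neq0 _)).
apply: le_trans; rewrite lee_fin normB -mulrBr /q.
have a0 : 0 <= a by exact: sqrtr_ge0.
rewrite !normrM !normfV normr_nat (ltr0_norm h0) (ger0_norm a0) -expr2.
by rewrite -[leRHS]mulrA [_^-1 * _]mulrC.
Unshelve. all: by end_near. Qed.

(* The tolerances in the last two conjuncts are half a unit of the last
   printed digit of -0.1348 and 0.0505. *)
Theorem theorem4p2 (R : realType) :
  (forall r : R, 2 <= r ->
     normF (thetaR r) = r /\
     ((3 / 8 * `|derive1n 2 (@phi R) 1| * r ^+ 2)%:E <= lipschitz_grad (@Jstar R) r)%E)
  /\ derive1n 2 (@phi R) 1 = - 8 * sin 1 - 10 * cos 1 + 12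
  /\ `|derive1n 2 (@phi R) 1 - (- (1348 / 10 ^+ 4))| <= 5 / 10 ^+ 5
  /\ `|3 / 8 * `|derive1n 2 (@phi R) 1| - 505 / 10 ^+ 4| <= 5 / 10 ^+ 5.
Proof.
have phi2 := derive1n2_phi R.
have /andP[lb ub] := sin1_cos1_bounds R.
have phi2N : `|derive1n 2 (@phi R) 1| = 8 * sin 1 + 10 * cos 1 - 12.
  rewrite phi2 ler0_norm; lra.
split=> [r r2|]; last by rewrite phi2N phi2; split => //; split; rewrite ler_norml; lra.
split.
  rewrite /thetaR -(scale1r (delta_mx 0 0)) normF_line sqr_sqrtr ?subr_ge0; last nra.
  by rewrite expr1n addrC subrK sqrtr_sqr ger0_norm //; lra.
apply: le_trans (lipschitz_grad_Jstar_ge _ r _); last lra.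
(* 3/8 r^2 <= (r^2 - 1)/2 amounts to r^2 >= 4. *)
rewrite lee_fin mulrAC ler_wpM2r //; nra.
Qed.
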